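(* Let $n\ge 1$ be an integer and let $a(s)=s^n+a_1s^{n-1}+\cdots+a_n\in H^n$ be a monic real Hurwitz stable polynomial of order $n$. Then the set $\Omega_{1a}\subset\mathbb{R}^n$ is a non-empty, open, unbounded, convex subset of $\mathbb{R}^n$.
   Context: $P^n$ denotes the set of real polynomials of order (exact degree) $n$. $H^n\subset P^n$ denotes the set of Hurwitz stable polynomials of order $n$ (all roots have negative real part). A rational function $p(s)=b(s)/a(s)$ is called strictly positive real (SPR), of order $n$, if $b\in P^n$, $a\in H^n$, and $\mathrm{Re}[p(j\omega)]>0$ for all $\omega\in\mathbb{R}$, where $j$ is the imaginary unit. For a monic $a\in H^n$, $\Omega_{1a}$ is the set of all $(x_1,x_2,\dots,x_n)\in\mathbb{R}^n$ such that, with $b(s)=s^n+x_1s^{n-1}+\cdots+x_n$, the rational function $b(s)/a(s)$ is SPR. *)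

(* Defs.v *)
From mathcomp Require Import all_boot all_order all_algebra.
From mathcomp Require Import complex.
From mathcomp Require Import all_classical all_reals all_analysis.
Import Order.TTheory GRing.Theory Num.Theory.
Import numFieldNormedType.Exports.

Set Implicit Arguments.
Unset Strict Implicit.
Unset Printing Implicit Defensive.

Local Open Scope classical_set_scope.
Local Open Scope ring_scope.

Definition ceval (R : realType) (p : {poly R}) (z : R[i]) : R[i] :=
  (map_poly (real_complex R) p).[z].

(* Exact degree [n]: in particular the zero polynomial is excluded. *)
Definition poly_order (R : realType) (n : nat) : set {poly R} :=
  [set p | size p = n.+1].

Definition hurwitz (R : realType) (n : nat) : set {poly R} :=
  [set p | poly_order n p /\
           forall z : R[i], ceval p z = 0 -> complex.Re z < 0].

(* A rational function is given by the pair of its numerator [b] and its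
   denominator [a], which are not required to be coprime. *)
Definition SPR (R : realType) (n : nat) (b a : {poly R}) : Prop :=
  [/\ poly_order n b, hurwitz n a &
      forall w : R, 0 < complex.Re (ceval b (0 +i* w)%C / ceval a (0 +i* w)%C)].

(* s^n + x_1 s^(n-1) + ... + x_n, where [x 0 i] stands for x_(i+1). *)
Definition monic_of_coefs (R : realType) (n : nat) (x : 'rV[R]_n) : {poly R} :=
  'X^n + \sum_(i < n) x 0 i *: 'X^(n - i.+1).

Definition Omega1 (R : realType) (n : nat) (a : {poly R}) : set 'rV[R]_n :=
  [set x | SPR n (monic_of_coefs x) a].

Arguments Omega1 {R} n a.

(* Main.v *)
(* Write A for the Hurwitz polynomial. Re(b(jw)/A(jw)) is affine in the
   coefficients of b, so the set is convex; b = A has quotient 1.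
   Factoring A over its roots gives |A(jw)| >= C (1 + |w|)^n, so the quotient
   depends on the coefficients in a Lipschitz way, uniformly in w, with a
   constant decaying like 1/(1 + |w|). Hence the quotient of an element of the
   set is bounded away from 0, which gives openness. Finally Re(A'/A) >= 0 on
   the imaginary axis, so the ray A + t A' stays in the set. *)
Require Import Defs.
From mathcomp Require Import all_boot all_order all_algebra.
From mathcomp Require Import complex ring lra.
From mathcomp Require Import all_classical all_reals all_analysis.
Import Order.TTheory GRing.Theory Num.Theory.
Import numFieldNormedType.Exports.

Set Implicit Arguments.
Unset Strict Implicit.
Unset Printing Implicit Defensive.

Import ComplexField.Normc.
Local Open Scope classical_set_scope.
Local Open Scope ring_scope.

(** * Real part and modulus of complex numbers *)

Lemma ReD (R : rcfType) (x y : R[i]) :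
  complex.Re (x + y) = complex.Re x + complex.Re y.
Proof. by case: x; case: y. Qed.

Lemma Re_sum (R : rcfType) (I : finType) (F : I -> R[i]) :
  complex.Re (\sum_i F i) = \sum_i complex.Re (F i).
Proof. exact: (big_morph _ (@ReD R)). Qed.

Lemma ReMl (R : rcfType) (k : R) (x : R[i]) :
  complex.Re (real_complex R k * x) = k * complex.Re x.
Proof. by case: x => x y /=; rewrite mul0r subr0. Qed.

Lemma Re_div (R : rcfType) (x y : R[i]) :
  complex.Re (x / y) =
  (complex.Re x * complex.Re y + complex.Im x * complex.Im y)
  / (complex.Re y ^+ 2 + complex.Im y ^+ 2).
Proof. by case: x => a b; case: y => c d /=; rewrite mulrDl; ring. Qed.

Lemma ler_Re_normc (R : rcfType) (x : R[i]) : `|complex.Re x| <= normc x.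
Proof.
by case: x => a b /=; rewrite -sqrtr_sqr ler_wsqrtr // lerDl sqr_ge0.
Qed.

Lemma ler_Im_normc (R : rcfType) (x : R[i]) : `|complex.Im x| <= normc x.
Proof.
by case: x => a b /=; rewrite -sqrtr_sqr ler_wsqrtr // lerDr sqr_ge0.
Qed.

Lemma normc_ge0 (R : rcfType) (x : R[i]) : 0 <= normc x.
Proof. exact: le_trans (normr_ge0 _) (ler_Re_normc x). Qed.

Lemma normc_gt0 (R : rcfType) (x : R[i]) : (0 < normc x) = (x != 0).
Proof.
rewrite lt_def normc_ge0 andbT; congr (~~ _).
by apply/eqP/eqP => [/eq0_normc//|->]; rewrite normc0.
Qed.

Lemma normcX (R : rcfType) (x : R[i]) k : normc (x ^+ k) = normc x ^+ k.
Proof. by elim: k => [|k IH]; rewrite ?expr0 ?normc1 // !exprS normcM IH. Qed.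

Lemma normc_imag (R : rcfType) (w : R) : normc (0 +i* w)%C = `|w|.
Proof. by rewrite /= expr0n add0r sqrtr_sqr. Qed.

#[local] Arguments normc : simpl never.

(** * Evaluation of real polynomials at complex points *)

Section Ceval.
Variables (R : realType) (z : R[i]).

Lemma cevalD (p q : {poly R}) : ceval (p + q) z = ceval p z + ceval q z.
Proof. by rewrite /ceval rmorphD hornerD. Qed.

Lemma ceval_sum (I : finType) (F : I -> {poly R}) :
  ceval (\sum_i F i) z = \sum_i ceval (F i) z.
Proof. by rewrite /ceval rmorph_sum horner_sum. Qed.

Lemma cevalZ (k : R) (p : {poly R}) :
  ceval (k *: p) z = real_complex R k * ceval p z.
Proof. by rewrite /ceval map_polyZ hornerZ. Qed.

Lemma cevalXn k : ceval 'X^k z = z ^+ k.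
Proof. by rewrite /ceval map_polyXn hornerXn. Qed.

End Ceval.

(** Reduces continuity in [w] to that of real polynomials in [w]. *)
Lemma imag_parts (R : realType) (p : {poly R}) :
  exists u v : {poly R}, forall w : R,
    ceval p (0 +i* w)%C = (u.[w] +i* v.[w])%C.
Proof.
elim/poly_ind: p => [|p c [u [v uv]]].
  by exists 0, 0 => w; rewrite /ceval rmorph0 !horner0.
(* Multiplication by [jw] turns [u + jv] into [-wv + jwu]. *)
exists (c%:P - v * 'X), (u * 'X) => w.
rewrite cevalD -['X]expr1; rewrite {1}/ceval rmorphM hornerM -!/(ceval _ _).
rewrite uv cevalXn /ceval map_polyC hornerC !hornerE expr1.
by apply/eqP; rewrite eq_complex /=; apply/andP; split; apply/eqP; ring.
Qed.

(** * Products of linear factors with roots in the open left half-plane *)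

Section StableProduct.
Variable R : rcfType.
Implicit Types (z : R[i]) (rs : seq R[i]) (w : R).

Lemma imag_sub_lower z : complex.Re z < 0 ->
  exists2 K : R, 0 < K &
    forall w, 1 + `|w| <= K * normc ((0 +i* w)%C - z).
Proof.
case: z => x y /= x0; have x1 : 0 < `|x| by rewrite normr_gt0 lt_eqF.
(* The modulus is at least [|w| - |y|] and at least [|x| > 0]. The summand 1 pays for [|w| - |y|],
   the other one for the remaining [1 + |y|]. *)
exists (1 + (1 + `|y|) / `|x|) => [|w].
  by rewrite addr_gt0 // divr_gt0 // ltr_pwDl.
have := ler_Re_normc ((0 +i* w) - (x +i* y))%C.
have := ler_Im_normc ((0 +i* w) - (x +i* y))%C.
set N := normc _; rewrite /= add0r normrN => Ni Nr.
rewrite mulrDl mul1r (_ : 1 + `|w| = `|w| - `|y| + (1 + `|y|)); last by ring.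
apply: lerD; first exact: le_trans (lerB_dist _ _) Ni.
by rewrite mulrAC -mulrA ler_peMr ?addr_ge0 // ler_pdivlMr // mul1r.
Qed.

Lemma stable_prod_lower rs : (forall z, z \in rs -> complex.Re z < 0) ->
  exists2 K : R, 0 < K & forall w,
    (1 + `|w|) ^+ size rs
    <= K * normc (\prod_(z <- rs) ('X - z%:P)).[(0 +i* w)%C].
Proof.
elim: rs => [_|z rs IH rs0].
  by exists 1 => // w; rewrite big_nil hornerC normc1 mulr1.
have [K K0 HK] := imag_sub_lower (rs0 z (mem_head _ _)).
have [|L L0 HL] := IH; first by move=> t trs; apply: rs0; rewrite inE trs orbT.
exists (K * L) => [|w]; first exact: mulr_gt0.
rewrite big_cons hornerM hornerXsubC normcM mulrACA /= exprS.
by apply: ler_pM; rewrite ?exprn_ge0 ?addr_ge0.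
Qed.

(* [P'/P = \sum 1/(s - z)], and each [1/(jw - z)] has positive real part. *)
Lemma stable_prod_logderiv rs w : (forall z, z \in rs -> complex.Re z < 0) ->
  let P := \prod_(z <- rs) ('X - z%:P) in
  0 <= complex.Re (P^`().[(0 +i* w)%C] / P.[(0 +i* w)%C]).
Proof.
elim: rs => [_|z rs IH rs0] /=.
  by rewrite big_nil derivC horner0 mul0r.
have z0 := rs0 z (mem_head _ _).
have {}IH := IH (fun t trs => rs0 t (@mem_behead _ (z :: rs) t trs)).
rewrite big_cons; set Q := \prod_(_ <- _) _ in IH *.
rewrite derivM derivXsubC mul1r !hornerE.
set s := (0 +i* w)%C in IH *.
(* If [Q] vanishes at [s], the quotient is 0, since the inverse of 0 is 0 by convention. *)
have [->|Q0] := eqVneq Q.[s] 0; first by rewrite mulr0 invr0 mulr0.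
have sz : s - z != 0.
  by apply: contraTneq z0 => /eqP; rewrite subr_eq0 => /eqP <-; rewrite ltxx.
have -> : (Q.[s] + (s - z) * Q^`().[s]) / ((s - z) * Q.[s])
          = 1 / (s - z) + Q^`().[s] / Q.[s].
  by field; rewrite sz Q0.
(* The real part of [1/(s - z)] is [- Re z] over a squared modulus. *)
rewrite ReD addr_ge0 // Re_div /= mulr_ge0 ?invr_ge0 ?addr_ge0 ?sqr_ge0 //.
  by case: (z) z0 => x y /= x0; rewrite mul1r add0r oppr_ge0 ltW.
by rewrite mul0r.
Qed.

End StableProduct.

(** * Hurwitz polynomials on the imaginary axis *)

Section Hurwitz.
Variables (R : realType) (n : nat) (a : {poly R}).
Hypothesis ha : hurwitz n a.
Implicit Types w : R.

Lemma hurwitz_factor : exists c (rs : seq R[i]),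
  [/\ c != 0, size rs = n, forall z, z \in rs -> complex.Re z < 0 &
      map_poly (real_complex R) a = c *: \prod_(z <- rs) ('X - z%:P)].
Proof.
case: ha => an az; pose aC := map_poly (real_complex R) a.
have [rs Ers] := closed_field_poly_normal aC.
have a0 : lead_coef aC != 0.
  by rewrite lead_coef_eq0 map_poly_eq0 -size_poly_eq0 an.
exists (lead_coef aC), rs; split => //.
  apply: succn_inj; rewrite -an -(size_map_poly (real_complex R)) -/aC Ers.
  by rewrite size_scale // size_prod_XsubC.
move=> z zrs; apply: az; apply/eqP; rewrite -/(root aC _) Ers rootZ //.
by rewrite root_prod_XsubC.
Qed.

Lemma hurwitz_lower : exists2 K : R, 0 < K & forall w,
  (1 + `|w|) ^+ n <= K * normc (ceval a (0 +i* w)%C).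
Proof.
have [c [rs [c0 <- rs0 E]]] := hurwitz_factor.
have [K K0 HK] := stable_prod_lower rs0.
exists (K / normc c) => [|w]; first by rewrite divr_gt0 // normc_gt0.
rewrite /ceval E hornerZ normcM mulrA divfK //.
by rewrite gt_eqF // normc_gt0.
Qed.

Lemma hurwitz_neq0 w : ceval a (0 +i* w)%C != 0.
Proof.
apply/eqP => a0; have [_ /(_ _ a0)] := ha.
by rewrite ltxx.
Qed.

Lemma hurwitz_logderiv w :
  0 <= complex.Re (ceval a^`() (0 +i* w)%C / ceval a (0 +i* w)%C).
Proof.
have [c [rs [c0 _ rs0 E]]] := hurwitz_factor.
rewrite /ceval -deriv_map E derivZ !hornerZ -mulf_div divff // mul1r.
exact: stable_prod_logderiv.
Qed.

(** For [k < n], [|w|^k (1 + |w|)] is at most [(1 + |w|)^n], which the lower bound on [|a(jw)|]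
    controls. *)
Lemma hurwitz_Xn_bound : exists2 K : R, 0 < K & forall w k, (k < n)%N ->
  `|complex.Re ((0 +i* w)%C ^+ k / ceval a (0 +i* w)%C)| <= K / (1 + `|w|).
Proof.
have [K K0 HK] := hurwitz_lower; exists K => // w k kn.
apply: le_trans (ler_Re_normc _) _; rewrite normcM normcV normcX normc_imag.
have w1 : 0 < 1 + `|w| by rewrite ltr_pwDl.
rewrite ler_pdivrMr ?normc_gt0 ?hurwitz_neq0 // mulrAC ler_pdivlMr //.
apply: le_trans (HK w).
apply: (@le_trans _ _ ((1 + `|w|) ^+ k.+1)).
  by rewrite exprSr ler_wpM2r ?(ltW w1) ?lerXn2r ?nnegrE ?(ltW w1) ?lerDr.
by rewrite ler_weXn2l // lerDl.
Qed.

(** Written with real and imaginary parts, this is a quotient of real polynomials in [w] whose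
    denominator [|a(jw)|^2] has no zero. *)
Lemma hurwitz_Re_continuous (b : {poly R}) : continuous (fun w : R =>
  complex.Re (ceval b (0 +i* w)%C / ceval a (0 +i* w)%C)).
Proof.
have [u [v uv]] := imag_parts b; have [p [q pq]] := imag_parts a.
have -> : (fun w => complex.Re (ceval b (0 +i* w)%C / ceval a (0 +i* w)%C)) =
  (fun w => (u * p + v * q).[w] / (p ^+ 2 + q ^+ 2).[w]).
  by apply/funext => w; rewrite uv pq Re_div !hornerE.
move=> w; apply: cvgM; first exact: continuous_horner.
apply: cvgV; last exact: continuous_horner.
apply: contraNneq (hurwitz_neq0 w); rewrite pq !hornerE => /eqP.
by rewrite paddr_eq0 ?sqr_ge0 // !sqrf_eq0 eq_complex.
Qed.

End Hurwitz.

(** * The quotient as an affine function of the coefficient vector *)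

Section Coefs.
Variables (R : realType) (n : nat).
Implicit Types (x y : 'rV[R]_n) (a : {poly R}).

Lemma size_monic_of_coefs x : size (monic_of_coefs x) = n.+1.
Proof.
rewrite /monic_of_coefs size_polyDl ?size_polyXn // ltnS.
apply: (leq_trans (size_sum _ _ _)); apply/bigmax_leqP => i _.
apply: (leq_trans (size_scale_leq _ _)).
by rewrite size_polyXn subnSK // leq_subr.
Qed.

Lemma coef_monic_of_coefs x : (monic_of_coefs x)`_n = 1.
Proof.
rewrite /monic_of_coefs coefD coefXn eqxx coef_sum big1 ?addr0 // => i _.
rewrite coefZ coefXn gtn_eqF ?mulr0 // ltn_subrL /=.
exact: leq_ltn_trans (ltn_ord i).
Qed.

(** The leading terms cancel, so only powers below [n] separate two monic polynomials; this is what
    makes differences of quotients decay in [w]. *)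
Lemma monic_of_coefsE x y : monic_of_coefs x =
  monic_of_coefs y + \sum_(i < n) (x 0 i - y 0 i) *: 'X^(n - i.+1).
Proof.
rewrite /monic_of_coefs -addrA -big_split /=; congr (_ + _);
apply: eq_bigr => i _.
by rewrite -scalerDl subrKC.
Qed.

(** Coefficient vectors list the highest power first; this lets a polynomial of degree below [n],
    such as [A'], serve as a direction. *)
Lemma sum_rev_coefs (p : {poly R}) : (size p <= n)%N ->
  \sum_(i < n) p`_(n - i.+1) *: 'X^(n - i.+1) = p.
Proof.
move=> pn; rewrite -[RHS](coefK p) (poly_def) (reindex_inj rev_ord_inj) /=.
rewrite (big_ord_widen n (fun i => p`_i *: 'X^i) pn) [RHS]big_mkcond /=.
apply: eq_bigr => i _; rewrite subnSK // subKn ?(ltnW (ltn_ord i)) //.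
by case: ltnP => // pi; rewrite nth_default // scale0r.
Qed.

Definition Re_quot a x (w : R) : R :=
  complex.Re (ceval (monic_of_coefs x) (0 +i* w)%C / ceval a (0 +i* w)%C).

Lemma Omega1E a : hurwitz n a ->
  Omega1 n a = [set x | forall w, 0 < Re_quot a x w].
Proof.
move=> ha; apply/seteqP; split => x /=; first by case.
by move=> x0; split => //; exact: size_monic_of_coefs.
Qed.

Lemma Re_quotE a x y w : Re_quot a x w = Re_quot a y w +
  \sum_(i < n) (x 0 i - y 0 i) *
     complex.Re ((0 +i* w)%C ^+ (n - i.+1) / ceval a (0 +i* w)%C).
Proof.
rewrite /Re_quot (monic_of_coefsE x y) cevalD mulrDl ReD; congr (_ + _).
rewrite ceval_sum mulr_suml Re_sum; apply: eq_bigr => i _.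
by rewrite cevalZ cevalXn -mulrA ReMl.
Qed.

Lemma Re_quot_conv a x y k w :
  Re_quot a (k *: x + (1 - k) *: y) w =
  k * Re_quot a x w + (1 - k) * Re_quot a y w.
Proof.
(* All three quotients are expanded at the vector 0; the constant terms combine because the weights
   sum to 1. *)
rewrite (Re_quotE a x 0) (Re_quotE a y 0) (Re_quotE a _ 0)
  !mulrDr addrACA -mulrDl subrKC mul1r; congr (_ + _).
rewrite !mulr_sumr -big_split; apply: eq_bigr => i _.
by rewrite !mxE /=; ring.
Qed.

End Coefs.

(** * Openness, convexity and unboundedness *)

Section OmegaTopology.
Variables (R : realType) (n : nat) (a : 'rV[R]_n).
Hypothesis ha : hurwitz n (monic_of_coefs a).
Let A := monic_of_coefs a.

Lemma Re_quot_self w : Re_quot A a w = 1.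
Proof. by rewrite /Re_quot divff ?(hurwitz_neq0 ha). Qed.

Lemma Re_quot_lipschitz : exists2 K : R, 0 < K &
  forall (x y : 'rV[R]_n) w,
    `|Re_quot A x w - Re_quot A y w|
    <= K * (\sum_i `|x 0 i - y 0 i|) / (1 + `|w|).
Proof.
have [K K0 HK] := hurwitz_Xn_bound ha; exists K => // x y w.
rewrite (Re_quotE _ x y) addrAC subrr add0r mulrAC mulr_sumr.
apply: le_trans (ler_norm_sum _ _ _) _; apply: ler_sum => i _.
by rewrite normrM mulrC ler_wpM2r // HK // subnSK // leq_subr.
Qed.

(* Both polynomials being monic, the quotient tends to 1 at infinity; elsewhere
   compactness gives the bound. *)
Lemma Omega1_margin x : Omega1 n A x ->
  exists2 d : R, 0 < d & forall w, d <= Re_quot A x w.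
Proof.
rewrite Omega1E // => /= x0.
have [K K0 HK] := Re_quot_lipschitz.
(* Beyond [M] the Lipschitz bound keeps the quotient within 1/2 of its value 1 at [a]; on [[-M, M]]
   it attains a minimum. *)
pose M := 2 * (K * \sum_i `|x 0 i - a 0 i|).
have M0 : 0 <= M by rewrite !mulr_ge0 ?(ltW K0) ?sumr_ge0.
have [c _ cmin] : exists2 c, c \in `[- M, M] &
    forall t, t \in `[- M, M] -> Re_quot A x c <= Re_quot A x t.
  apply: EVT_min; first by rewrite ge0_cp.
  apply: continuous_subspaceT; exact: (hurwitz_Re_continuous ha).
exists (Num.min (Re_quot A x c) 2^-1).
  by rewrite lt_min x0 invr_gt0 ltr0n.
move=> w; rewrite ge_min; have [wM|Mw] := leP `|w| M.
  by rewrite cmin // in_itv /= -ler_norml.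
apply/orP; right; have := HK x a w; rewrite Re_quot_self.
set q := Re_quot A x w; have w1 : 0 < 1 + `|w| by rewrite ltr_pwDl.
rewrite ler_pdivlMr // => q1.
have : `|q - 1| * (1 + `|w|) <= 2^-1 * (1 + `|w|).
  apply: le_trans q1 _; rewrite ler_pdivlMl //.
  by rewrite -/M; lra.
by rewrite ler_pM2r // ler_norml => /andP[h _]; lra.
Qed.

Lemma Omega1_open : open (Omega1 n A).
Proof.
rewrite openE => x /[dup] Ox /Omega1_margin[d d0 xd].
have [K K0 HK] := Re_quot_lipschitz.
(* The [n] coordinate differences, each at most this radius, sum to at most [n/(n+1) * d/K]. The
   [n + 1] makes this strictly less than [d/K] and keeps the radius positive for [n = 0]. *)
apply/nbhs_ballP; exists (d / (K * n.+1%:R)) => [|y [_ xy]].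
  by rewrite /= divr_gt0 // mulr_gt0.
rewrite Omega1E //= => w.
have : `|Re_quot A x w - Re_quot A y w| < d.
  apply: le_lt_trans (HK x y w) _.
  have w1 : 0 < 1 + `|w| by rewrite ltr_pwDl.
  rewrite ltr_pdivrMr //; apply: (@lt_le_trans _ _ d); last first.
    by rewrite ler_peMr ?(ltW d0) // lerDl.
  rewrite mulrC -ltr_pdivlMr //.
  apply: (@le_lt_trans _ _ (\sum_(i < n) d / (K * n.+1%:R))).
    by apply: ler_sum => i _; apply/ltW/(xy 0 i).
  rewrite sumr_const card_ord invfM mulrA -[ltLHS]mulr_natr -[ltLHS]mulrA.
  by rewrite gtr_pMr ?divr_gt0 // mulrC ltr_pdivrMr ?ltr0Sn // mul1r ltr_nat.
by rewrite ltr_norml => /andP[_]; have := xd w; lra.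
Qed.

Lemma Omega1_convex : convex_set (Omega1 n A).
Proof.
(* Only weights strictly between 0 and 1 remain, so both terms of the combination are positive. *)
rewrite Omega1E //; apply/convex_setW => x y /set_mem x0 /set_mem y0 k k0 k1.
apply/mem_set => w.
have -> : conv k x y = k%:num *: x + (1 - k%:num) *: y by [].
by rewrite Re_quot_conv addr_gt0 // mulr_gt0 // subr_gt0.
Qed.

Lemma Omega1_unbounded : (0 < n)%N -> ~ bounded_set (Omega1 n A).
Proof.
(* [c] holds the coefficients of [A'] from [s^(n-1)] down, so [a + t *: c] encodes [A + t A']. *)
move=> n0; pose c : 'rV[R]_n := \row_i A^`()`_(n - i.+1).
have cO t : 0 <= t -> Omega1 n A (a + t *: c).
  move=> t0; rewrite Omega1E //= => w.
  have -> : Re_quot A (a + t *: c) w = 1 + t *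
      complex.Re (ceval A^`() (0 +i* w)%C / ceval A (0 +i* w)%C).
    rewrite -(Re_quot_self w) /Re_quot -ReMl mulrA -cevalZ -ReD -mulrDl -cevalD.
    congr (complex.Re (ceval _ _ / _)).
    rewrite (monic_of_coefsE _ a); congr (_ + _).
    have s : (size A^`() <= n)%N.
      rewrite -ltnS -(size_monic_of_coefs a) lt_size_deriv //.
      by rewrite -size_poly_eq0 size_monic_of_coefs.
    rewrite -[in RHS](sum_rev_coefs s) scaler_sumr; apply: eq_bigr => i _.
    by rewrite !mxE scalerA; congr (_ *: _); ring.
  by rewrite ltr_pwDl // mulr_ge0 // (hurwitz_logderiv ha).
(* The first entry of [c] is the leading coefficient [n] of [A']. *)
have c0 : c != 0.
  apply/eqP => /matrixP/(_ 0 (Ordinal n0)); rewrite !mxE coef_deriv subn1.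
  by rewrite prednK // coef_monic_of_coefs => /eqP; rewrite pnatr_eq0 gtn_eqF.
case=> M [_ HM].
(* This [t] gives [t *: c] the norm [|M| + |a| + 2], so [a + t *: c] has norm at least [|M| + 2],
   above the assumed bound [|M| + 1]. *)
have t0 : 0 <= (`|M| + `|a| + 2) / `|c| by [].
have M1 : M < `|M| + 1 by rewrite ltr_pwDr // ler_norm.
have /= aM := HM _ M1 _ (cO _ t0).
have := ler_normD (a + ((`|M| + `|a| + 2) / `|c|) *: c) (- a).
rewrite addrAC subrr add0r normrN normrZ ger0_norm // divfK ?normr_eq0 //.
by lra.
Qed.

End OmegaTopology.

Unset Implicit Arguments.

Theorem theorem1 (R : realType) (n : nat) (hn : (1 <= n)%N)
    (a : 'rV[R]_n) (ha : hurwitz n (monic_of_coefs a)) :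
  [/\ Omega1 n (monic_of_coefs a) !=set0,
      open (Omega1 n (monic_of_coefs a)),
      ~ bounded_set (Omega1 n (monic_of_coefs a)) &
      convex_set (Omega1 n (monic_of_coefs a))].
Proof.
split.
- by exists a; rewrite Omega1E //= => w; rewrite Re_quot_self.
- exact: Omega1_open.
- exact: Omega1_unbounded.
- exact: Omega1_convex.
Qed.
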